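(* Let $V$ be a real normed linear space. Put $V^{(\cdot)} := V \times \mathbb{R}$ and $V^{(\cdot)+} := \{(v,\alpha) \in V \times \mathbb{R} : \|v\| \le \alpha\}$. Then $(V^{(\cdot)}, V^{(\cdot)+})$ is a real ordered vector space. For $(v,\alpha) \in V^{(\cdot)}$ define $$|(v,\alpha)| = \begin{cases} (v,\alpha), & \text{if } (v,\alpha) \in V^{(\cdot)+},\\ -(v,\alpha), & \text{if } (v,\alpha) \in -V^{(\cdot)+},\\ \left(\frac{\alpha}{\|v\|} v, \|v\|\right), & \text{if } (v,\alpha) \notin V^{(\cdot)+} \cup -V^{(\cdot)+}. \end{cases}$$ Then $(V^{(\cdot)}, V^{(\cdot)+}, |\cdot|)$ is an absolutely ordered space if and only if $V$ is strictly convex.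
   Context: $V \times \mathbb{R}$ carries the coordinatewise vector space operations. In a real ordered vector space $(U,U^+)$ ($U^+$ the cone of positive elements) one writes $x \le y$ if $y - x \in U^+$. A normed linear space is strictly convex if the line segment joining any two points of its unit sphere does not meet the unit sphere except at its end points. Absolutely ordered space: a real ordered vector space $(U,U^+)$ with a map $|\cdot| : U \to U^+$ such that (1) $|v| = v$ if $v \in U^+$; (2) $|v| \pm v \in U^+$ for all $v \in U$; (3) $|kv| = |k|\,|v|$ for all $v \in U$, $k \in \mathbb{R}$; (4) if $u,v,w \in U$ with $|u-v| = u+v$ and $|u-w| = u+w$, then $|u - |v \pm w|| = u + |v \pm w|$ (for both signs); (5) if $u,v,w \in U$ with $|u-v| = u+v$ and $0 \le w \le v$, then $|u-w| = u+w$. *)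

(* Defs.v *)
From HB Require Import structures.
From mathcomp Require Import all_boot all_order all_algebra.
From mathcomp Require Import all_classical all_reals all_analysis.
Set Implicit Arguments.
Unset Strict Implicit.
Unset Printing Implicit Defensive.
Import Order.TTheory GRing.Theory Num.Theory.
Import numFieldNormedType.Exports.
Local Open Scope classical_set_scope.
Local Open Scope ring_scope.

(* The cone is required to be proper, so that [cone_le] is a partial order. *)
Record ordered_vector_space (R : realType) (U : lmodType R) (P : set U) : Prop :=
  OrderedVectorSpace {
    cone0 : P 0 ;
    coneD : forall x y : U, P x -> P y -> P (x + y) ;
    coneZ : forall (k : R) (x : U), 0 <= k -> P x -> P (k *: x) ;
    cone_proper : forall x : U, P x -> P (- x) -> x = 0 }.

Definition cone_le (R : realType) (U : lmodType R) (P : set U) (x y : U) : Prop :=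
  P (y - x).

Record absolutely_ordered_space (R : realType) (U : lmodType R) (P : set U)
    (av : U -> U) : Prop := AbsolutelyOrderedSpace {
  aos_ordered : ordered_vector_space P ;
  aos_codom : forall v : U, P (av v) ;
  aos_pos : forall v : U, P v -> av v = v ;
  aos_pm : forall v : U, P (av v + v) /\ P (av v - v) ;
  aos_scale : forall (v : U) (k : R), av (k *: v) = `|k| *: av v ;
  aos_orth_abs : forall u v w : U,
    av (u - v) = u + v -> av (u - w) = u + w ->
    av (u - av (v + w)) = u + av (v + w) /\
    av (u - av (v - w)) = u + av (v - w) ;
  aos_orth_le : forall u v w : U,
    av (u - v) = u + v -> cone_le P 0 w -> cone_le P w v ->
    av (u - w) = u + w }.

Definition strictly_convex (R : realType) (V : normedModType R) : Prop :=
  forall (x y : V) (t : R), `|x| = 1 -> `|y| = 1 -> 0 <= t <= 1 ->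
    `|(1 - t) *: x + t *: y| = 1 ->
    (1 - t) *: x + t *: y = x \/ (1 - t) *: x + t *: y = y.

(* [R^o] is [R] as a module over itself: this makes the product an [lmodType R]
   with coordinatewise operations. *)
Definition norm_cone (R : realType) (V : normedModType R) : set (V * R^o) :=
  [set p | `|p.1| <= p.2].
Arguments norm_cone {R} V _.

Definition norm_abs (R : realType) (V : normedModType R) (p : V * R^o) :
    V * R^o :=
  if p \in norm_cone V then p
  else if - p \in norm_cone V then - p
  else ((p.2 / `|p.1|) *: p.1, `|p.1|).
Arguments norm_abs {R} V p.

(* Main.v *)
Require Import Defs.
From HB Require Import structures.
From mathcomp Require Import all_boot all_order all_algebra.
From mathcomp Require Import all_classical all_reals all_analysis.
From mathcomp Require Import ring lra.
Import Order.TTheory GRing.Theory Num.Theory.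
Import numFieldNormedType.Exports.
Local Open Scope classical_set_scope.
Local Open Scope ring_scope.

(** Write [u _|_ v] for [|u - v| = u + v].  The whole theorem rests on an explicit
    description of this relation ([orth_nonzeroP]): apart from the trivial cases where
    one side is [0] and the other is positive, [u _|_ v] holds exactly when [u] lies
    on the boundary [`|x| = a] of the cone and [v] is a nonnegative multiple of the
    mirror image [(- x, a)] of [u = (x, a)].  This is true in every normed space.

    Hence [aos_orth_abs] also holds in every normed space: the vectors orthogonal to a
    boundary vector [u != 0] form a single half-line, which is closed under
    [(v, w) |-> |v +- w|].  The remaining axioms are direct computations, except
    [aos_orth_le], the only one that sees the shape of the unit ball.

    [aos_orth_le] asks that every [w] with [0 <= w <= v] stay on the half-line of the
    boundary vector [v], that is, that boundary half-lines of the cone be extreme rays.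
    For [v = (m, 1)] with [`|m| = 1], equality in the triangle inequality turns the
    decompositions [v = (v - w) + w] into positive vectors into the ways of writing [m]
    as a convex combination of two unit vectors, so extremality is strict convexity:
    [boundary_ray_extreme] is one direction, and [strictly_convex_of_orth_le] applies
    the axiom to [u = (- m, 1)], [v = (m, 1)], [w = (t y, t)] for the other. *)

(** * The cone *)

Lemma norm_cone_ordered (R : realType) (V : normedModType R) :
  ordered_vector_space (norm_cone V).
Proof.
split; rewrite /norm_cone /=.
- by rewrite normr0.
- move=> [x a] [y b] /= xa yb.
  by apply: le_trans (ler_normD x y) _; apply: lerD.
- by move=> k [x a] k0 /= xa; rewrite normrZ ger0_norm// ler_wpM2l.
- move=> [x a] /= xa; rewrite normrN => xNa.
  have x0 : 0 <= `|x| := normr_ge0 x.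
  have a0 : a = 0 by lra.
  have /eqP : `|x| = 0 by lra.
  by rewrite normr_eq0 a0 => /eqP ->.
Qed.

Lemma norm_cone_trichotomy (R : realType) (V : normedModType R) (p : V * R^o) :
  [\/ norm_cone V p, norm_cone V (- p) | `|p.2 : R| < `|p.1|].
Proof.
case: p => x a; rewrite /norm_cone /= normrN.
case: (lerP `|x| a) => xa; first by constructor 1.
case: (lerP `|x| (- a)) => xNa; first by constructor 2.
by constructor 3; rewrite ltr_norml; apply/andP; split; lra.
Qed.

(** * The absolute value *)

Section AbsoluteValue.
Context {R : realType} {V : normedModType R}.
Implicit Types (u v w p : V * R^o) (k : R).
Let ovs := @norm_cone_ordered R V.

Lemma norm_abs_pos p : norm_cone V p -> norm_abs V p = p.
Proof. by move=> Pp; rewrite /norm_abs mem_set. Qed.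

Lemma norm_abs_neg p : norm_cone V (- p) -> norm_abs V p = - p.
Proof.
move=> PNp; rewrite /norm_abs; case: ifPn => [/set_mem Pp|_].
  by rewrite (cone_proper ovs Pp PNp) oppr0.
by rewrite mem_set.
Qed.

Lemma norm_abs_mid (x : V) (a : R^o) : `|a : R| < `|x| ->
  norm_abs V (x, a) = ((a / `|x|) *: x, `|x|).
Proof.
rewrite ltr_norml => /andP[aN xa]; rewrite /norm_abs !memNset //.
  by rewrite /norm_cone /= normrN => H; lra.
by rewrite /norm_cone /= => H; lra.
Qed.

Lemma norm_absN p : norm_abs V (- p) = norm_abs V p.
Proof.
have [Pp|PNp|] := norm_cone_trichotomy _ _ p.
- by rewrite (norm_abs_pos p)// norm_abs_neg ?opprK.
- by rewrite (norm_abs_neg p)// norm_abs_pos.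
- case: p => x a /= ax.
  have -> : - (x, a) = (- x, - a) :> V * R^o by [].
  rewrite !norm_abs_mid ?normrN//.
  by rewrite mulNr scaleNr scalerN opprK.
Qed.

Lemma norm_absZ_pos p k : 0 < k -> norm_abs V (k *: p) = k *: norm_abs V p.
Proof.
move=> k0; have [Pp|PNp|] := norm_cone_trichotomy _ _ p.
- by rewrite !norm_abs_pos//; apply: (coneZ ovs) => //; apply: ltW.
- rewrite !norm_abs_neg ?scalerN// -scalerN.
  by apply: (coneZ ovs) => //; apply: ltW.
- case: p => x a /= ax.
  have x0 : 0 < `|x| by apply: le_lt_trans ax.
  have -> : k *: (x, a) = (k *: x, k * a) :> V * R^o by [].
  have kn : `|k| = k by rewrite gtr0_norm.
  rewrite !norm_abs_mid//; last by rewrite normrM normrZ ltr_pM2l // kn.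
  rewrite normrZ kn; congr pair; rewrite !scalerA; congr (_ *: _).
  by field; rewrite !gt_eqF.
Qed.

Lemma norm_absZ p k : norm_abs V (k *: p) = `|k| *: norm_abs V p.
Proof.
case: (ltrgtP k 0) => [k0|k0|->].
- by rewrite -norm_absN -scaleNr norm_absZ_pos ?oppr_gt0// ltr0_norm.
- by rewrite norm_absZ_pos// gtr0_norm.
- by rewrite normr0 !scale0r norm_abs_pos//; apply: (cone0 ovs).
Qed.

(** Off the two cones, [|p| +- p] is [`|x| +- a] times [(x / `|x|, 1)] or its mirror
    image, hence lies on the boundary of the cone. *)
Lemma norm_abs_pm p :
  norm_cone V (norm_abs V p + p) /\ norm_cone V (norm_abs V p - p).
Proof.
have [Pp|PNp|] := norm_cone_trichotomy _ _ p.
- rewrite norm_abs_pos// subrr; split; last exact: (cone0 ovs).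
  exact: (coneD ovs).
- rewrite norm_abs_neg// addNr; split; first exact: (cone0 ovs).
  exact: (coneD ovs).
- case: p => x a /= ax; rewrite norm_abs_mid// /norm_cone /=.
  have x0 : 0 < `|x| by apply: le_lt_trans ax.
  move: ax; rewrite ltr_norml => /andP[aN xa].
  have -> : (a / `|x|) *: x + x = ((`|x| + a) / `|x|) *: x.
    by rewrite (mulrDl `|x|) scalerDl divff ?gt_eqF// scale1r addrC.
  have -> : (a / `|x|) *: x - x = - (((`|x| - a) / `|x|) *: x).
    by rewrite mulrBl scalerBl divff ?gt_eqF// scale1r opprB.
  have norm_rescaled (r : R) : `|(r / `|x|) *: x| = `|r|.
    by rewrite normrZ normrM normfV normr_id divfK ?gt_eqF.
  by rewrite normrN !norm_rescaled !ger0_norm ?lexx//; lra.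
Qed.

Lemma norm_abs_cone p : norm_cone V (norm_abs V p).
Proof.
have [P1 P2] := norm_abs_pm p.
have -> : norm_abs V p =
    2^-1 *: ((norm_abs V p + p) + (norm_abs V p - p)).
  rewrite addrACA subrr addr0 scalerDr -scalerDl.
  by rewrite (_ : 2^-1 + 2^-1 = 1) ?scale1r//; field.
by apply: (coneZ ovs); [rewrite invr_ge0|apply: (coneD ovs)].
Qed.

(** * Orthogonality *)

(** Because [|u - v| +- (u - v)] is then [2 u] or [2 v]. *)
Lemma orth_cone u v : norm_abs V (u - v) = u + v ->
  norm_cone V u /\ norm_cone V v.
Proof.
move=> uv; have := norm_abs_pm (u - v); rewrite uv.
have -> : u + v + (u - v) = 2 *: u.
  by rewrite addrACA subrr addr0 -mulr2n scaler_nat.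
have -> : u + v - (u - v) = 2 *: v.
  by rewrite opprB addrC addrA subrK -mulr2n scaler_nat.
have half p : norm_cone V (2 *: p) -> norm_cone V p.
  move=> Pp; have -> : p = 2^-1 *: (2 *: p).
    by rewrite scalerA mulVf ?scale1r// pnatr_eq0.
  by apply: (coneZ ovs) => //; rewrite invr_ge0.
by case=> /half ? /half ?.
Qed.

Lemma orth_0l v : norm_cone V v -> norm_abs V (0 - v) = 0 + v.
Proof. by move=> Pv; rewrite !add0r norm_absN norm_abs_pos. Qed.

Lemma orth_0r u : norm_cone V u -> norm_abs V (u - 0) = u + 0.
Proof. by move=> Pu; rewrite subr0 addr0 norm_abs_pos. Qed.

Definition mirror p : V * R^o := (- p.1, p.2).

Lemma orth_mirror u k : `|u.1| = u.2 -> 0 <= k ->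
  norm_abs V (u - k *: mirror u) = u + k *: mirror u.
Proof.
case: u => x a /= xa k0.
have : 0 <= a by rewrite -xa.
rewrite le_eqVlt => /orP[/eqP a0|a0].
  have /eqP : `|x| = 0 by rewrite xa -a0.
  rewrite normr_eq0 => /eqP x0; rewrite /mirror x0 -a0 /= oppr0 scaler0.
  by apply: orth_0r; apply: (cone0 ovs).
move: k0; rewrite le_eqVlt => /orP[/eqP <-|k0].
  by rewrite scale0r; apply: orth_0r; rewrite /norm_cone /= xa.
have -> : (x, a) - k *: mirror (x, a) = ((1 + k) *: x, (1 - k) * a).
  congr pair; first by rewrite /= scalerN opprK scalerDl scale1r.
  by rewrite /= mulrBl mul1r.
have nx : `|(1 + k) *: x| = (1 + k) * a by rewrite normrZ xa ger0_norm//; lra.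
rewrite norm_abs_mid nx; last first.
  rewrite normrM (gtr0_norm a0) ltr_pM2r// ltr_norml; apply/andP; split; lra.
congr pair; last by rewrite /= mulrDl mul1r.
have -> : x + k *: - x = (1 - k) *: x by rewrite scalerN scalerBl scale1r.
rewrite scalerA.
by congr (_ *: _); field; rewrite gt_eqF//= gt_eqF//; lra.
Qed.

(** In the middle case of the absolute value, [|u - v| = u + v] reads
    [a + b = `|x - y|] and [(a + b) (x + y) = (a - b) (x - y)] for [u = (x, a)] and
    [v = (y, b)]; the latter simplifies to [a y = - b x]. *)
Lemma orth_nonzeroP u v : u != 0 ->
  norm_abs V (u - v) = u + v <->
  norm_cone V u /\
  (v = 0 \/ `|u.1| = u.2 /\ exists2 k : R, 0 <= k & v = k *: mirror u).
Proof.
move=> u0; split; last first.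
  move=> [Pu [->|[ub [k k0 ->]]]]; first exact: orth_0r.
  exact: orth_mirror.
move=> uv; have [Pu Pv] := orth_cone _ _ uv; split=> //; move: uv.
have [Puv|PNuv|] := norm_cone_trichotomy _ _ (u - v).
- rewrite norm_abs_pos// => /addrI Nv; left.
  by apply: (cone_proper ovs) => //; rewrite Nv.
- rewrite norm_abs_neg// opprB addrC => /addIr Nu.
  by case/eqP: u0; apply: (cone_proper ovs) => //; rewrite Nu.
case: u v u0 Pu Pv => x a [y b] u0 /= Pu Pv ab.
rewrite norm_abs_mid// => -[exy eab]; right.
rewrite /norm_cone /= in Pu Pv.
move: ab exy; rewrite eab ltr_norml => /andP[abl abr] exy.
have a0 : 0 < a by lra.
have b0 : 0 < b by lra.
have s0 : a + b != 0 by rewrite gt_eqF// addr_gt0.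
have ayx : y = - ((b / a) *: x).
  have H : (a + b) *: (x + y) = (a - b) *: (x - y).
    by rewrite -exy scalerA mulrCA divff// mulr1.
  (* Comparing the coefficients of [x] and [y] in [H]. *)
  have E : 2 *: (b *: x + a *: y) = 0.
    rewrite -(subrr ((a - b) *: (x - y))) -{1}H.
    rewrite !scalerDr scalerN opprD opprK addrACA -scalerBl -scalerDl !scalerA.
    by congr (_ *: _ + _ *: _); ring.
  move/eqP: E; rewrite scaler_eq0 pnatr_eq0 /= addrC addr_eq0 => /eqP E.
  by rewrite mulrC -scalerA -scalerN -E scalerA mulVf ?gt_eqF// scale1r.
have k0 : 0 < b / a by rewrite divr_gt0.
split; last first.
  exists (b / a); first exact: ltW.
  congr pair; first by rewrite /= scalerN.
  by apply/esym/divfK; rewrite gt_eqF.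
have ny : x - y = ((a + b) / a) *: x.
  by rewrite ayx opprK mulrDl divff ?gt_eqF// scalerDl scale1r.
move: eab; rewrite ny normrZ gtr0_norm ?divr_gt0 ?addr_gt0// => eab.
have : (a + b) * (`|x| / a - 1) = 0.
  by rewrite mulrBr mulr1 mulrA mulrAC eab subrr.
move/eqP; rewrite mulf_eq0 (negbTE s0) subr_eq0 /= => /eqP xa.
by apply: divr1_eq.
Qed.

(** For [u != 0], the only vector that can be orthogonal to [u] is [0], unless [u] is a
    boundary vector; then the orthogonal vectors form the half-line of [mirror u], and
    on the line it spans the absolute value sends [l *: mirror u] to
    [`|l| *: mirror u]. *)
Lemma orth_abs_comb u v w k :
  norm_abs V (u - v) = u + v -> norm_abs V (u - w) = u + w ->
  norm_abs V (u - norm_abs V (v + k *: w)) = u + norm_abs V (v + k *: w).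
Proof.
have [->|u0] := eqVneq u 0.
  by move=> _ _; apply: orth_0l; apply: norm_abs_cone.
move=> /(orth_nonzeroP _ _ u0)[Pu dv] /(orth_nonzeroP _ _ u0)[_ dw].
have [ub|uNb] := eqVneq (`|u.1|) (u.2 : R); last first.
  have -> : v = 0 by case: dv => // -[/eqP]; rewrite (negbTE uNb).
  have -> : w = 0 by case: dw => // -[/eqP]; rewrite (negbTE uNb).
  rewrite scaler0 addr0 (norm_abs_pos 0); last exact: (cone0 ovs).
  exact: orth_0r.
have on_mirror v' : v' = 0 \/ `|u.1| = u.2 /\
    (exists2 l : R, 0 <= l & v' = l *: mirror u) -> exists l : R, v' = l *: mirror u.
  by case=> [->|[_ [l _ ->]]]; [exists 0; rewrite scale0r|exists l].
have [l ->] := on_mirror _ dv; have [l' ->] := on_mirror _ dw.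
rewrite scalerA -scalerDl norm_absZ (norm_abs_pos (mirror u)).
  exact: orth_mirror.
by rewrite /norm_cone /mirror /= normrN ub.
Qed.

(** * Strict convexity and extreme rays *)

(** If [v = (x, b)] and [w = (y, c)], the triangle inequality for
    [x = y + (x - y)] must be an equality, so for [0 < c < b] the vector [x / b] is
    the convex combination of the unit vectors [y / c] and [(x - y) / (b - c)] with
    weights [c / b] and [(b - c) / b]. *)
Lemma boundary_ray_extreme v w : strictly_convex V ->
  `|v.1| = v.2 -> norm_cone V w -> norm_cone V (v - w) ->
  exists k : R, w = k *: v.
Proof.
case: v w => x b [y c] scV; rewrite /norm_cone /= => xb yc xyc.
have tri : `|x| <= `|y| + `|x - y|.
  by rewrite -{1}(subrK y x) addrC ler_normD.
have ny : `|y| = c by lra.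
have nxy : `|x - y| = b - c by lra.
have c0 : 0 <= c by rewrite -ny.
have bc0 : 0 <= b - c by rewrite -nxy.
move: c0; rewrite le_eqVlt => /orP[/eqP c0|c0].
  exists 0; move/eqP: ny; rewrite -c0 normr_eq0 => /eqP ->.
  by rewrite scale0r.
move: bc0; rewrite le_eqVlt => /orP[/eqP bc0|bc0].
  exists 1; move/eqP: nxy; rewrite -bc0 normr_eq0 subr_eq0 => /eqP ->.
  by rewrite scale1r; congr pair; lra.
have b0 : 0 < b by lra.
have bN0 : b != 0 by rewrite gt_eqF.
have cN0 : c != 0 by rewrite gt_eqF.
have bcN0 : b - c != 0 by rewrite gt_eqF.
have comb : (1 - (b - c) / b) *: (c^-1 *: y) +
    ((b - c) / b) *: ((b - c)^-1 *: (x - y)) = b^-1 *: x.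
  rewrite !scalerA.
  have -> : (1 - (b - c) / b) / c = b^-1 by field; rewrite bN0 cN0.
  have -> : (b - c) / b / (b - c) = b^-1 by field; rewrite bN0 bcN0.
  by rewrite -scalerDr addrC subrK.
have unit_norm (z : V) (r : R) : 0 < r -> `|z| = r -> `|r^-1 *: z| = 1.
  move=> r0 zr; rewrite normrZ zr normfV gtr0_norm// mulVf//.
  by rewrite gt_eqF.
have := scV (c^-1 *: y) ((b - c)^-1 *: (x - y)) ((b - c) / b)
  (unit_norm _ _ c0 ny) (unit_norm _ _ bc0 nxy).
have t01 : 0 <= (b - c) / b <= 1.
  apply/andP; split; first by apply: divr_ge0; apply: ltW.
  rewrite -subr_ge0 (_ : 1 - (b - c) / b = c / b); last by field.
  by apply: divr_ge0; apply: ltW.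
rewrite comb => /(_ t01 (unit_norm _ _ b0 xb)) alt.
exists (c / b).
have -> : (c / b) *: (x, b) = ((c / b) *: x, c / b * b) :> V * R^o by [].
rewrite divfK//; congr pair; case: alt => [xy|xy].
  by rewrite -scalerA xy scalerA divff// scale1r.
have : (b - c) *: (b^-1 *: x) = x - y by rewrite xy scalerA divff// scale1r.
rewrite scalerA mulrBl divff// scalerBl scale1r => /addrI.
by move/oppr_inj.
Qed.

Lemma orth_le_of_strictly_convex u v w : strictly_convex V ->
  norm_abs V (u - v) = u + v -> norm_cone V w -> norm_cone V (v - w) ->
  norm_abs V (u - w) = u + w.
Proof.
move=> scV; have [->|u0] := eqVneq u 0; first by move=> _ Pw _; exact: orth_0l.
move=> /(orth_nonzeroP _ _ u0)[Pu [->|[ub [k k0 ->]]]] Pw Pvw.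
  rewrite sub0r in Pvw; rewrite (cone_proper ovs Pw Pvw); exact: orth_0r.
have [|l ew] := boundary_ray_extreme (k *: mirror u) w scV _ Pw Pvw.
  by rewrite /= normrZ normrN ub ger0_norm.
move: Pw; rewrite ew scalerA => Pw.
have [lk0|lk0] := leP 0 (l * k); first exact: orth_mirror.
have Pm : norm_cone V (- ((l * k) *: mirror u)).
  rewrite -scaleNr; apply: (coneZ ovs); first by rewrite oppr_ge0 ltW.
  by rewrite /norm_cone /mirror /= normrN ub.
rewrite (cone_proper ovs Pw Pm); exact: orth_0r.
Qed.

(** With [m = (1 - t) x + t y], both [(t y, t)] and
    [(m, 1) - (t y, t) = ((1 - t) x, 1 - t)] are positive; so [(t y, t)] is orthogonal
    to [(- m, 1)], and thus proportional to [(m, 1)]. *)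
Lemma strictly_convex_of_orth_le :
  (forall u v w, norm_abs V (u - v) = u + v ->
    norm_cone V w -> norm_cone V (v - w) -> norm_abs V (u - w) = u + w) ->
  strictly_convex V.
Proof.
move=> orth_le x y t x1 y1 /andP[t0 t1]; set m := _ + _ => m1.
have [t_eq0|tN0] := eqVneq t 0.
  by left; rewrite /m t_eq0 subr0 scale1r scale0r addr0.
right; pose u : V * R^o := (- m, 1).
have uN0 : u != 0 by apply/eqP => -[_ /eqP]; rewrite oner_eq0.
have Pw : norm_cone V (t *: y, t).
  by rewrite /norm_cone /= normrZ y1 mulr1 ger0_norm.
have Pvw : norm_cone V (1 *: mirror u - (t *: y, t)).
  rewrite scale1r /norm_cone /mirror /= opprK /m addrK.
  by rewrite normrZ x1 mulr1 ger0_norm// subr_ge0.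
have uv : norm_abs V (u - 1 *: mirror u) = u + 1 *: mirror u.
  by apply: orth_mirror => //=; rewrite normrN.
have /(orth_nonzeroP _ _ uN0)[_ []] := orth_le _ _ _ uv Pw Pvw.
  by move=> -[_ t_eq0]; rewrite t_eq0 eqxx in tN0.
move=> [_ [k _]] [ty tk]; move: ty.
have -> : k = t by rewrite tk; apply/esym/mulr1.
by rewrite opprK => /(scalerI tN0).
Qed.

End AbsoluteValue.

Theorem theorem2p14 (R : realType) (V : normedModType R) :
  ordered_vector_space (norm_cone V) /\
  (absolutely_ordered_space (norm_cone V) (norm_abs V) <-> strictly_convex V).
Proof.
split; first exact: norm_cone_ordered.
split=> [aos|scV].
  apply: strictly_convex_of_orth_le => u v w uv Pw Pvw.
  by apply: (aos_orth_le aos uv) => //; rewrite /cone_le subr0.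
split.
- exact: norm_cone_ordered.
- exact: norm_abs_cone.
- exact: norm_abs_pos.
- exact: norm_abs_pm.
- exact: norm_absZ.
- move=> u v w uv uw; split.
    by have := orth_abs_comb _ _ _ 1 uv uw; rewrite scale1r.
  by have := orth_abs_comb _ _ _ (-1) uv uw; rewrite scaleN1r.
- move=> u v w uv; rewrite /cone_le subr0.
  exact: orth_le_of_strictly_convex.
Qed.
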